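(* Let $n\ge 3$ and let $g=\sum_{i=1}^n dx_i^2$ be the Euclidean metric on $\mathbb{R}^n$ with coordinates $x_1,\dots,x_n$. Fix $k\in\{1,\dots,n\}$ and let $R=T\odot g$ where $T=\sum_{i=1}^n f_i(x_k)\,dx_i^2$ and $f_1,\dots,f_n$ are smooth functions depending only on the variable $x_k$, such that $3f_i(x_k)+f_j(x_k)\neq0$ for all $x_k\in\mathbb{R}$ and all $i\neq j$. Then there exists a metric $\bar g=\frac{1}{\varphi^2}g$ on $\mathbb{R}^n$ (with $\varphi$ a positive smooth function) whose Riemannian curvature tensor satisfies $\bar R=R$ if and only if all the functions $f_i$ with $i\neq k$ are equal to one another, say $f_i=f$ for $i\ne k$, and for some constant $C>0$ the functions $f$ and $f_k$ satisfy the system $$\begin{cases}\displaystyle\frac12\left(\frac{f_{,x_k}}{3f+f_k}\right)^2-\left(\frac{f_{,x_k}}{3f+f_k}\right)_{,x_k}=C^2f_k\,v,\\[2mm] \displaystyle-\left(\frac{f_{,x_k}}{3f+f_k}\right)^2=2C^2f\,v,\end{cases}$$ where $v=v(x_k)=\exp\left(-2\int\frac{f_{,x_k}}{3f+f_k}\,dx_k\right)$. If $f_k$ and $f$ satisfy these conditions, then $\varphi$ depends only on $x_k$ and is given by $$\varphi(x_k)=C\exp\left(-\int\frac{f_{,x_k}}{3f+f_k}\,dx_k\right).$$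
   Context: Subscripts $_{,x_k}$ denote derivatives with respect to $x_k$; $\int\frac{f_{,x_k}}{3f+f_k}\,dx_k$ denotes one fixed antiderivative, the same in all places. For symmetric $(0,2)$-tensors $h,l$ the Kulkarni–Nomizu product is $(h\odot l)(X,Y,Z,W)=h(X,Z)l(Y,W)+h(Y,W)l(X,Z)-h(X,W)l(Y,Z)-h(Y,Z)l(X,W)$. The Riemannian curvature $(0,4)$-tensor is taken with the sign convention for which a metric $\tilde g$ of constant sectional curvature $c$ has curvature tensor $\frac{c}{2}\,\tilde g\odot\tilde g$; equivalently $R_{\tilde g}=W_{\tilde g}+A_{\tilde g}\odot\tilde g$ with $W_{\tilde g}$ the Weyl tensor and $A_{\tilde g}=\frac{1}{n-2}\left(\mathrm{Ric}_{\tilde g}-\frac{K_{\tilde g}}{2(n-1)}\tilde g\right)$ the Schouten tensor, $K_{\tilde g}$ being the scalar curvature. *)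

(* Defs.v *)
From HB Require Import structures.
From mathcomp Require Import all_boot all_order all_algebra.
From mathcomp Require Import boolp classical_sets functions reals.
From mathcomp Require Import topology normedtype sequences derive realfun exp.

Set Implicit Arguments.
Unset Strict Implicit.
Unset Printing Implicit Defensive.

Import Order.TTheory GRing.Theory Num.Theory.
Import numFieldNormedType.Exports.

Local Open Scope ring_scope.
Local Open Scope classical_set_scope.

(* Tensor fields on R^n = 'rV[R]_n are given by their components in the
   global coordinate frame; a symmetric (0,2)-tensor is a matrix. *)

Definition partial (R : realType) (n : nat) (i : 'I_n)
    (F : 'rV[R]_n -> R) (x : 'rV[R]_n) : R :=
  'D_(delta_mx 0 i) F x.

Fixpoint Ck (R : realType) (n : nat) (r : nat) (F : 'rV[R]_n -> R) : Prop :=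
  continuous F /\
  if r is r'.+1 then
    forall i : 'I_n,
      (forall x, derivable F x (delta_mx 0 i)) /\ Ck r' (partial i F)
  else True.

Definition smooth (R : realType) (n : nat) (F : 'rV[R]_n -> R) : Prop :=
  forall r, Ck r F.

Definition smooth1 (R : realType) (f : R -> R) : Prop :=
  forall r t, derivable (f^`(r)) t 1.

Definition tensor4 (R : realType) (n : nat) : Type :=
  'I_n -> 'I_n -> 'I_n -> 'I_n -> R.

Definition kulkarni_nomizu (R : realType) (n : nat) (h l : 'M[R]_n) :
    tensor4 R n :=
  fun a b c d =>
    h a c * l b d + h b d * l a c - h a d * l b c - h b c * l a d.

Definition euclidean (R : realType) (n : nat) : 'M[R]_n := 1%:M.

Definition conformal (R : realType) (n : nat) (phi : 'rV[R]_n -> R)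
    (x : 'rV[R]_n) : 'M[R]_n :=
  (1 / phi x ^+ 2) *: euclidean R n.

(* christoffel G m i j is the symbol Gamma^m_{ij} of the metric G. *)
Definition christoffel (R : realType) (n : nat) (G : 'rV[R]_n -> 'M[R]_n)
    (m i j : 'I_n) (x : 'rV[R]_n) : R :=
  2^-1 * \sum_(l < n) invmx (G x) m l *
    (partial i (fun y => G y j l) x + partial j (fun y => G y i l) x
     - partial l (fun y => G y i j) x).

(* The m-th component of Rm(e_a, e_b) e_d, where
   Rm(X, Y) Z = D_X D_Y Z - D_Y D_X Z - D_[X, Y] Z. *)
Definition curvature_endo (R : realType) (n : nat) (G : 'rV[R]_n -> 'M[R]_n)
    (x : 'rV[R]_n) (a b d m : 'I_n) : R :=
  partial a (christoffel G m b d) x - partial b (christoffel G m a d) x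
  + \sum_(p < n) (christoffel G m a p x * christoffel G p b d x
                  - christoffel G m b p x * christoffel G p a d x).

(* The (0,4)-tensor (X, Y, Z, W) |-> G(Rm(X, Y) W, Z): with this order of the
   arguments constant sectional curvature c means c/2 times the
   Kulkarni-Nomizu square of G. *)
Definition riemann (R : realType) (n : nat) (G : 'rV[R]_n -> 'M[R]_n)
    (x : 'rV[R]_n) : tensor4 R n :=
  fun a b c d => \sum_(m < n) G x c m * curvature_endo G x a b d m.

Definition conformal_solution (R : realType) (n : nat)
    (Rt : 'rV[R]_n -> tensor4 R n) (phi : 'rV[R]_n -> R) : Prop :=
  [/\ smooth phi,
      (forall x, 0 < phi x) &
      (forall x a b c d, riemann (conformal phi) x a b c d = Rt x a b c d)].

(* prim selects one antiderivative of every continuous function; it gives a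
   meaning to the indefinite integral sign. *)
Definition antiderivative_choice (R : realType)
    (prim : (R -> R) -> R -> R) : Prop :=
  forall h : R -> R, continuous h ->
    forall t : R, is_derive t 1 (prim h) (h t).

Definition fratio (R : realType) (f fk : R -> R) (t : R) : R :=
  derive1 f t / (3 * f t + fk t).

Definition ode_system (R : realType) (prim : (R -> R) -> R -> R)
    (f fk : R -> R) (C : R) : Prop :=
  let w := fratio f fk in
  let v := fun t => expR (- 2 * prim w t) in
  forall t : R,
    1 / 2 * w t ^+ 2 - derive1 w t = C ^+ 2 * fk t * v t /\
    - (w t ^+ 2) = 2 * C ^+ 2 * f t * v t.

(* Main.v *)
Require Import Defs.
From HB Require Import structures.
From mathcomp Require Import all_boot all_order all_algebra.
From mathcomp Require Import boolp classical_sets functions reals.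
From mathcomp Require Import topology normedtype sequences derive realfun exp.
From mathcomp Require Import ring lra.

Import Order.TTheory GRing.Theory Num.Theory.
Import numFieldNormedType.Exports.

Local Open Scope ring_scope.
Local Open Scope classical_set_scope.

(** For the conformally flat metric [phi^-2 g] the curvature tensor is
    [phi^-2 (B (.) g)], where [B] is
    [Hess phi / phi - |grad phi|^2 / (2 phi^2) g] and [(.)] is the Kulkarni-Nomizu
    product.  As [n >= 3], the product with [g] is injective, so the
    problem is the system [B = phi^2 T], that is [phi_ij = 0] for [i <> j] and
    [phi phi_ii - |grad phi|^2 / 2 = phi^4 f_i].  For [j <> k],
    differentiating the [k]-th of these equations along [x_j] and subtracting
    the [j]-th gives [(3 f_k + f_j) phi_j = 0]; hence [phi] depends only on
    [x_k].  What remains is a pair of ordinary differential equations, whose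
    compatibility reads [phi' (3 f + f_k) = - phi f'] and determines [phi] up to
    a constant, which the system itself fixes because [3 f + f_k <> 0]. *)

Set Implicit Arguments.
Unset Strict Implicit.
Unset Printing Implicit Defensive.

(** * Calculus of directional derivatives *)

Section DirectionalDerivatives.
Context {R : realType} {V : normedModType R}.
Implicit Types (F G : V -> R) (x v : V).

Lemma is_derive_fun_eq F G x v (a b : R) :
  is_derive x v F a -> F =1 G -> a = b -> is_derive x v G b.
Proof. by move=> dF /funext <- <-. Qed.

Lemma is_derive_addf F G x v (a b : R) :
  is_derive x v F a -> is_derive x v G b ->
  is_derive x v (fun y => F y + G y) (a + b).
Proof. by move=> dF dG; exact: is_deriveD. Qed.

Lemma is_derive_mulf F G x v (a b : R) :
  is_derive x v F a -> is_derive x v G b ->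
  is_derive x v (fun y => F y * G y) (a * G x + F x * b).
Proof.
move=> dF dG; apply: (is_derive_fun_eq (F := F * G)) => //.
by rewrite addrC mulrC.
Qed.

Lemma is_derive_invf F x v (a : R) : is_derive x v F a -> F x != 0 ->
  is_derive x v (fun y => (F y)^-1) (- a / F x ^+ 2).
Proof.
move=> dF F0; have dF' : derivable F x v by exact: ex_derive.
apply: DeriveDef; first exact: derivableV.
by rewrite deriveV // (@derive_val _ _ _ _ _ _ _ dF) mulNr -mulrN mulrC.
Qed.

Lemma is_derive_cstf (c : R) x v : is_derive x v (fun _ => c) 0.
Proof. exact: is_derive_cst. Qed.

Lemma is_derive_mulcf (c : R) F x v (a : R) :
  is_derive x v F a -> is_derive x v (fun y => c * F y) (c * a).
Proof.
move=> dF; have D := is_derive_mulf (is_derive_cstf c x v) dF.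
apply: (is_derive_fun_eq D) => //.
by ring.
Qed.

Lemma is_derive_sumf (n : nat) (F : 'I_n -> V -> R) x v (a : 'I_n -> R) :
  (forall i, is_derive x v (F i) (a i)) ->
  is_derive x v (fun y => \sum_i F i y) (\sum_i a i).
Proof.
move=> dF; apply: (is_derive_fun_eq (F := \sum_i F i)) => //.
by move=> y; rewrite fct_sumE.
Qed.

(** Both difference quotients are the same function of the increment, so existence and value of the
    limit transfer without a chain rule, hence without total differentiability of [F]. *)
Lemma is_derive_line F x v (s a : R) :
  is_derive (x + s *: v) v F a -> is_derive s 1 (fun t : R => F (x + t *: v)) a.
Proof.
case=> dF eF.
have E : (fun h : R => h^-1 *:
      (((fun t : R => F (x + t *: v)) \o shift s) (h *: 1) - F (x + s *: v)))
    = (fun h : R => h^-1 *: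
      ((F \o shift (x + s *: v)) (h *: v) - F (x + s *: v))).
  apply/funext => h /=; congr (_ *: (F _ - _)).
  have -> : h *: (1 : R) = h by rewrite /GRing.scale /= mulr1.
  by rewrite scalerDl addrCA.
by apply: DeriveDef; rewrite /derivable /derive E.
Qed.

Lemma derive0_line F x v (s : R) :
  (forall y, is_derive y v F 0) -> F (x + s *: v) = F x.
Proof.
move=> dF; have := @is_derive_0_is_cst R (fun t => F (x + t *: v)) s 0.
by rewrite scale0r addr0; apply=> t; exact: is_derive_line.
Qed.

End DirectionalDerivatives.

(** * Partial derivatives and dependence on a single coordinate *)

Section Partials.
Context {R : realType} {n : nat}.
Implicit Types (F G : 'rV[R]_n -> R) (x y : 'rV[R]_n) (i j k : 'I_n).

Lemma is_derive_partial i F x : derivable F x (delta_mx 0 i) ->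
  is_derive x (delta_mx 0 i) F (partial i F x).
Proof. by move=> ?; apply: DeriveDef. Qed.

Lemma partial_val i F x (a : R) :
  is_derive x (delta_mx 0 i) F a -> partial i F x = a.
Proof. by move=> dF; rewrite /partial (@derive_val _ _ _ _ _ _ _ dF). Qed.

Lemma is_derive_coord i k (h : R -> R) x (a : R) :
  is_derive (x 0 k) 1 h a ->
  is_derive x (delta_mx 0 i) (fun y => h (y 0 k)) ((i == k)%:R * a).
Proof.
case=> dh eh; pose H (y : 'rV[R]_n) := h (y 0 k).
have E : (fun s : R => s^-1 *: ((H \o shift x) (s *: delta_mx 0 i) - H x))
    = (fun s : R => s^-1 *: (h (s * (i == k)%:R + x 0 k) - h (x 0 k))).
  by apply/funext => s /=; rewrite /H !mxE eqxx /= (eq_sym k).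
have [eik|nik] := eqVneq i k.
  move: E; rewrite eik eqxx mul1r => E.
  by apply: DeriveDef; rewrite /derivable /derive -/(partial k _ x) E.
move: E; rewrite (negbTE nik) mul0r => E.
have {}E : (fun s : R => s^-1 *: ((H \o shift x) (s *: delta_mx 0 i) - H x))
    = (fun _ : R => 0).
  by rewrite E; apply/funext => s; rewrite mulr0 add0r subrr scaler0.
apply: DeriveDef; rewrite /derivable /derive E; first exact: is_cvg_cst.
exact: lim_cst.
Qed.

Lemma Ck_partial r F i : Ck r.+1 F -> Ck r (partial i F).
Proof. by case=> _ /(_ i) []. Qed.

Lemma Ck_derivable r F i x : Ck r.+1 F -> derivable F x (delta_mx 0 i).
Proof. by case=> _ /(_ i) []. Qed.

(** [F] is invariant under translations along the j-th axis, and such translations commute with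
    [partial i]. For [F = partial k phi] this does the work of exchanging derivatives at third
    order. *)
Lemma partial_invariant i j F :
  (forall x, derivable F x (delta_mx 0 j)) -> (forall x, partial j F x = 0) ->
  forall x (s : R),
  partial i F (x + s *: delta_mx 0 j) = partial i F x.
Proof.
move=> dF F0 x s.
have eF : (fun z => F (z + s *: delta_mx 0 j)) = F.
  apply/funext => z; apply: derive0_line => y.
  by rewrite -(F0 y); exact: is_derive_partial.
rewrite -[in RHS]eF /partial /derive.
suff -> : (fun h : R => h^-1 *: ((F \o shift (x + s *: delta_mx 0 j))
      (h *: delta_mx 0 i) - F (x + s *: delta_mx 0 j)))
  = (fun h : R => h^-1 *: (((fun z => F (z + s *: delta_mx 0 j)) \o shift x)
      (h *: delta_mx 0 i) - F (x + s *: delta_mx 0 j))) by [].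
by apply/funext => h /=; rewrite addrA.
Qed.

(** Pass from [x] to [y] one coordinate at a time: each move off the k-th axis keeps [F] constant,
    and the k-th move has length zero. *)
Lemma eq_fun_of_partial0 k F :
  (forall j, j != k -> forall x, derivable F x (delta_mx 0 j)) ->
  (forall j, j != k -> forall x, partial j F x = 0) ->
  forall x y, x 0 k = y 0 k -> F x = F y.
Proof.
move=> dF F0 x y exy.
(* Summing over an arbitrary list of indices makes the sequence of moves an induction; the full
   index list gives [y]. *)
have step (r : seq 'I_n) :
    F (x + \sum_(j <- r) (y - x) 0 j *: delta_mx 0 j) = F x.
  elim: r => [|j r IH]; first by rewrite big_nil addr0.
  rewrite -[in RHS]IH big_cons addrCA addrC.
  have [->|jk] := eqVneq j k; first by rewrite !mxE exy subrr scale0r addr0.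
  apply: derive0_line => z.
  by rewrite -(F0 j jk z); apply: is_derive_partial; exact: dF.
by rewrite -(step (index_enum _)) -row_sum_delta addrC subrK.
Qed.

End Partials.

(** * Curvature of a conformally flat metric *)

Lemma sum_eq_natl {R : realType} {n : nat} (m : 'I_n) (F : 'I_n -> R) :
  \sum_l (m == l)%:R * F l = F m.
Proof.
rewrite (bigD1 m) //= eqxx mul1r big1 ?addr0 // => l lm.
by rewrite eq_sym (negbTE lm) mul0r.
Qed.

Section ConformalCurvature.
Context {R : realType} {n : nat}.
(** The derivatives are given as functions [d] and [dd], so that the computation serves both an
    unknown [phi] with its partials and an explicit factor with closed formulas. *)
Variables (phi : 'rV[R]_n -> R) (d : 'I_n -> 'rV[R]_n -> R).
Variable dd : 'I_n -> 'I_n -> 'rV[R]_n -> R.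
Hypothesis phi_gt0 : forall x, 0 < phi x.
Hypothesis dphi : forall i x, is_derive x (delta_mx 0 i) phi (d i x).
Hypothesis ddphi :
  forall i j x, is_derive x (delta_mx 0 i) (d j) (dd i j x).

(** These are the gradient of [log phi] and its derivatives; the Christoffel symbols are linear in
    [u]. *)
Let u (i : 'I_n) (x : 'rV[R]_n) := d i x / phi x.
Let du i j x := dd i j x / phi x - u i x * u j x.

Let phi_neq0 x : phi x != 0. Proof. by rewrite gt_eqF. Qed.

Let partial_conformal i j l x :
  partial i (fun y => conformal phi y j l) x =
  (j == l)%:R * (- 2 * d i x / phi x ^+ 3).
Proof.
have d2 := is_derive_mulf (dphi i x) (dphi i x).
have d3 := is_derive_invf d2 (mulf_neq0 (phi_neq0 x) (phi_neq0 x)).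
apply: partial_val; apply: (is_derive_fun_eq (is_derive_mulcf (j == l)%:R d3)).
  by move=> y; rewrite !mxE mul1r expr2 mulrC.
by field.
Qed.

Let invmx_conformal x m l :
  invmx (conformal phi x) m l = (m == l)%:R * phi x ^+ 2.
Proof.
rewrite /conformal /euclidean scalemx1 invmx_scalar !mxE mul1r invrK.
by rewrite mulr_natl.
Qed.

(** The usual conformal change formula over a flat background, with metric [exp(2 s) g] and
    [s = - log phi]. *)
Let christoffel_conformal m i j x :
  christoffel (conformal phi) m i j x =
  (i == j)%:R * u m x - (j == m)%:R * u i x - (i == m)%:R * u j x.
Proof.
pose E (p q : 'I_n) := (p == q)%:R : R.
rewrite /christoffel (eq_bigr (fun l => E m l * (phi x ^+ 2 *
  (E j l * (- 2 * d i x / phi x ^+ 3) + E i l * (- 2 * d j x / phi x ^+ 3)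
   - E i j * (- 2 * d l x / phi x ^+ 3))))).
  by rewrite sum_eq_natl /u -/(E i j) -/(E j m) -/(E i m); field.
move=> l _; rewrite invmx_conformal (partial_conformal i j l).
by rewrite (partial_conformal j i l) (partial_conformal l i j) !mulrA.
Qed.

Let is_derive_u i j x : is_derive x (delta_mx 0 i) (u j) (du i j x).
Proof.
have d1 := is_derive_mulf (ddphi i j x)
  (is_derive_invf (dphi i x) (phi_neq0 x)).
by apply: (is_derive_fun_eq d1) => //; rewrite /du /u; field.
Qed.

Let partial_christoffel a m i j x :
  partial a (christoffel (conformal phi) m i j) x =
  (i == j)%:R * du a m x - (j == m)%:R * du a i x - (i == m)%:R * du a j x.
Proof.
apply: partial_val.
have D c b := is_derive_mulcf c (is_derive_u a b x).
apply: (is_derive_fun_eq (is_derive_addf (is_derive_addf (D (i == j)%:R m)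
  (D (- (j == m)%:R) i)) (D (- (i == m)%:R) j))).
  by move=> y; rewrite christoffel_conformal !mulNr.
by rewrite !mulNr.
Qed.

Let christoffel_mul m a b e x :
  \sum_p christoffel (conformal phi) m a p x
         * christoffel (conformal phi) p b e x =
  - (a == e)%:R * u m x * u b x - (a == b)%:R * u m x * u e x
  + (e == m)%:R * u a x * u b x + (b == m)%:R * u a x * u e x
  - (a == m)%:R * (b == e)%:R * (\sum_p u p x ^+ 2)
  + 2 * (a == m)%:R * u b x * u e x.
Proof.
set S := \sum_p u p x ^+ 2.
(* Expand the first symbol into its three terms. Two of them contain a Kronecker delta in [p] and
   contract at once; only against the third, with factor [u p], is the second symbol expanded, and
   this produces [S]. *)
transitivity (\sum_p (
    (a == p)%:R * (u m x * christoffel (conformal phi) p b e x)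
  - (m == p)%:R * (u a x * christoffel (conformal phi) p b e x)
  - (a == m)%:R * ((b == e)%:R * u p x ^+ 2 - (e == p)%:R * (u p x * u b x)
      - (b == p)%:R * (u p x * u e x)))).
  apply: eq_bigr => p _; rewrite !christoffel_conformal (eq_sym p m).
  by ring.
rewrite !sumrB -!mulr_sumr !sumrB -!mulr_sumr -/S !sum_eq_natl.
rewrite !christoffel_conformal (eq_sym e a) (eq_sym b a).
by ring.
Qed.

(** The Schouten tensor of [phi^-2 g], once [dd] is known to be symmetric; the Weyl tensor of this
    metric vanishes. *)
Definition conformal_schouten (x : 'rV[R]_n) : 'M[R]_n :=
  \matrix_(a, b) (dd a b x / phi x
    - (a == b)%:R * (2^-1 * \sum_p (d p x / phi x) ^+ 2)).

(* The term with [dd a b x - dd b a x] vanishes by Clairaut's theorem; keeping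
   it makes that theorem unnecessary. *)
Lemma riemann_conformal x a b c e :
  riemann (conformal phi) x a b c e =
  phi x ^- 2 * (kulkarni_nomizu (conformal_schouten x) (euclidean R n) a b c e
    - (e == c)%:R * (dd a b x - dd b a x) / phi x).
Proof.
rewrite /riemann.
rewrite (eq_bigr (fun m => (c == m)%:R *
    (phi x ^- 2 * curvature_endo (conformal phi) x a b e m))); last first.
  by move=> m _; rewrite !mxE mul1r mulrA [(c == m)%:R * _]mulrC.
rewrite sum_eq_natl /curvature_endo sumrB !christoffel_mul !partial_christoffel.
rewrite /kulkarni_nomizu /conformal_schouten /euclidean !mxE /du -!/(u _ _).
rewrite (eq_sym b a).
set S := \sum_p u p x ^+ 2; set p := phi x.
by field; exact: phi_neq0.
Qed.
End ConformalCurvature.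

(** * Injectivity of the Kulkarni-Nomizu product with the Euclidean metric *)

Lemma exists_third_index n (a b : 'I_n) : (3 <= n)%N ->
  exists2 c : 'I_n, c != a & c != b.
Proof.
move=> n3; have : (0 < #|[predC pred2 a b]|)%N.
  rewrite -(ltn_add2l #|pred2 a b|) cardC card_ord addn0 card2.
  by apply: leq_trans n3; case: (a != b).
by case/card_gt0P => c; rewrite !inE negb_or => /andP[]; exists c.
Qed.

(** The entries [(i,j,i,j)] give the sums [A i i + A j j], and three distinct indices determine each
    summand; the entry [(l,i,l,j)] gives [A i j]. The restriction [c != e] keeps to entries where
    the antisymmetric term of [riemann_conformal] is absent. *)
Lemma kulkarni_nomizu_euclidean_inj (R : realType) n (A B : 'M[R]_n) :
  (3 <= n)%N ->
  (forall a b c e, c != e ->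
    kulkarni_nomizu A (euclidean R n) a b c e =
    kulkarni_nomizu B (euclidean R n) a b c e) ->
  A = B.
Proof.
move=> n3 AB; have diag i j : i != j -> A i i + A j j = B i i + B j j.
  move=> ij; have := AB i j i j ij; rewrite /kulkarni_nomizu !mxE !eqxx.
  by rewrite (eq_sym j) (negbTE ij) !mulr1 !mulr0 !subr0.
apply/matrixP => i j; have [<-|ij] := eqVneq i j.
  have [l li _] := exists_third_index i i n3.
  have [m mi ml] := exists_third_index i l n3.
  have := diag _ _ li; have := diag _ _ mi; have := diag _ _ ml.
  by lra.
have [l li lj] := exists_third_index i j n3.
have := AB l i l j lj; rewrite /kulkarni_nomizu !mxE !eqxx.
rewrite (negbTE ij) (negbTE lj) (eq_sym i) (negbTE li).
by rewrite !mulr1 !mulr0 !subr0 !add0r.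
Qed.

Lemma kulkarni_nomizuZl (R : realType) n (s : R) (A B : 'M[R]_n) a b c e :
  kulkarni_nomizu (s *: A) B a b c e = s * kulkarni_nomizu A B a b c e.
Proof. by rewrite /kulkarni_nomizu !mxE; ring. Qed.

(** * Smooth functions of one variable *)

Section SmoothFunctions.
Context {R : realType}.
Implicit Types (f g h : R -> R) (m r : nat) (t : R).

(** A finite-order form of [smooth1]: closure properties go by induction on [m], since a first
    derivative formula raises the order by one. *)
Definition differentiable_upto m f := forall r, (r < m)%N ->
  forall t, derivable (f^`(r)) t 1.

Lemma smooth1_upto f : smooth1 f <-> forall m, differentiable_upto m f.
Proof. by split=> [sf m r _|df r]; [exact: sf|exact: (df r.+1)]. Qed.

Lemma derive1_eq f g : (forall t, is_derive t 1 f (g t)) -> f^`() = g.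
Proof.
move=> df; apply/funext => t.
by rewrite derive1E (@derive_val _ _ _ _ _ _ _ (df t)).
Qed.

Lemma is_derive_derive1 f t : derivable f t 1 -> is_derive t 1 f (derive1 f t).
Proof. by move=> df; rewrite derive1E; exact: DeriveDef. Qed.

Lemma differentiable_uptoS m f g : (forall t, is_derive t 1 f (g t)) ->
  differentiable_upto m g -> differentiable_upto m.+1 f.
Proof.
move=> df dg [_ t|r rm t]; first exact: ex_derive.
by rewrite derive1Sn (derive1_eq df); exact: dg.
Qed.

Lemma differentiable_upto_derive m f : differentiable_upto m.+1 f ->
  (forall t, is_derive t 1 f (derive1 f t))
  /\ differentiable_upto m (derive1 f).
Proof.
move=> df; split=> [t|r rm t]; first exact/is_derive_derive1/(df 0%N).
by rewrite -derive1Sn; exact: df.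
Qed.

Lemma differentiable_upto0 f : differentiable_upto 0 f.
Proof. by move=> r; rewrite ltn0. Qed.

Lemma differentiable_uptoW m f :
  differentiable_upto m.+1 f -> differentiable_upto m f.
Proof. by move=> df r rm; apply: df; exact: ltnW. Qed.

Lemma differentiable_upto_cst m (c : R) : differentiable_upto m (fun _ => c).
Proof.
elim: m c => [|m IH] c; first exact: differentiable_upto0.
by apply: (@differentiable_uptoS _ _ (fun=> 0)) => // t; exact: is_derive_cstf.
Qed.

Lemma differentiable_uptoD m f g : differentiable_upto m f ->
  differentiable_upto m g -> differentiable_upto m (fun t => f t + g t).
Proof.
elim: m f g => [|m IH] f g; first by move=> _ _; exact: differentiable_upto0.
move=> /differentiable_upto_derive[df sf] /differentiable_upto_derive[dg sg].
apply: (differentiable_uptoS (fun t => is_derive_addf (df t) (dg t))).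
exact: IH.
Qed.

Lemma differentiable_uptoM m f g : differentiable_upto m f ->
  differentiable_upto m g -> differentiable_upto m (fun t => f t * g t).
Proof.
elim: m f g => [|m IH] f g sf0 sg0; first exact: differentiable_upto0.
have [df sf] := differentiable_upto_derive sf0.
have [dg sg] := differentiable_upto_derive sg0.
apply: (differentiable_uptoS (fun t => is_derive_mulf (df t) (dg t))).
exact: (differentiable_uptoD (IH _ _ sf (differentiable_uptoW sg0))
  (IH _ _ (differentiable_uptoW sf0) sg)).
Qed.

Lemma differentiable_uptoV m f : (forall t, f t != 0) ->
  differentiable_upto m f -> differentiable_upto m (fun t => (f t)^-1).
Proof.
move=> f0; elim: m => [|m IH] sf0; first exact: differentiable_upto0.
have [df sf] := differentiable_upto_derive sf0.
have sV := IH (differentiable_uptoW sf0).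
have dV t : is_derive t 1 (fun s => (f s)^-1)
    (-1 * derive1 f t * ((f t)^-1 * (f t)^-1)).
  apply: (is_derive_fun_eq (is_derive_invf (df t) (f0 t))) => //.
  by field; exact: f0.
apply: (differentiable_uptoS dV).
exact: (differentiable_uptoM
  (differentiable_uptoM (@differentiable_upto_cst m (-1)) sf)
  (differentiable_uptoM sV sV)).
Qed.

Lemma smooth1_derive f : smooth1 f -> smooth1 (derive1 f).
Proof. by move=> sf r t; rewrite -derive1Sn; exact: sf. Qed.

Lemma smooth1M f g : smooth1 f -> smooth1 g -> smooth1 (fun t => f t * g t).
Proof.
rewrite !smooth1_upto => sf sg m; exact: differentiable_uptoM.
Qed.

Lemma smooth1_cst (c : R) : smooth1 (fun=> c).
Proof. by rewrite smooth1_upto => m; exact: differentiable_upto_cst. Qed.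

Lemma smooth1_is_derive f t : smooth1 f -> is_derive t 1 f (derive1 f t).
Proof. by move=> sf; apply: is_derive_derive1; exact: (sf 0%N). Qed.

Lemma smooth1_continuous f : smooth1 f -> continuous f.
Proof.
move=> sf t; apply: differentiable_continuous; apply/derivable1_diffP.
exact: (sf 0%N).
Qed.

(** Bootstrapping: if [h] is differentiable to order [m], so is its derivative [g * h], hence [h] is
    to order [m.+1]. *)
Lemma smooth1_linear_ode h g : smooth1 g ->
  (forall t, is_derive t 1 h (g t * h t)) -> smooth1 h.
Proof.
rewrite !smooth1_upto => sg dh.
elim=> [|m IH]; first exact: differentiable_upto0.
exact: (differentiable_uptoS dh (differentiable_uptoM (sg m) IH)).
Qed.

Lemma smooth1_fratio f g : smooth1 f -> smooth1 g ->
  (forall t, 3 * f t + g t != 0) -> smooth1 (fratio f g).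
Proof.
move=> sf sg fg0; apply: smooth1M; first exact: smooth1_derive.
move: sf sg; rewrite !smooth1_upto => sf sg m.
apply: differentiable_uptoV => //; apply: (differentiable_uptoD _ (sg m)).
exact: (differentiable_uptoM (@differentiable_upto_cst m 3) (sf m)).
Qed.

(** Every partial derivative is again a smooth function of the k-th coordinate, namely [dh] below,
    so the induction on the order must quantify over [h]. *)
Lemma smooth_coord n (k : 'I_n) h :
  smooth1 h -> smooth (fun x : 'rV[R]_n => h (x 0 k)).
Proof.
move=> sh r; elim: r h sh => [|r IH] h sh.
all: have ch : continuous (fun x : 'rV[R]_n => h (x 0 k)).
1, 3: move=> x; apply: (@continuous_comp _ _ _ (fun y : 'rV[R]_n => y 0 k) h).
1, 3: exact: coord_continuous.
1, 2: exact: smooth1_continuous.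
  by [].
split=> // i.
have D (x : 'rV[R]_n) := is_derive_coord i (smooth1_is_derive (x 0 k) sh).
split=> [x|]; first by case: (D x).
pose dh t : R := (i == k)%:R * derive1 h t.
rewrite (_ : partial _ _ = (fun x => dh (x 0 k))).
  apply: (IH dh); apply: smooth1M; first exact: smooth1_cst.
  exact: smooth1_derive.
by apply/funext => x; apply: partial_val.
Qed.

End SmoothFunctions.

(** * The ordinary differential system *)

Section OneVariable.
Context {R : realType}.
Implicit Types s t C : R.
Variables (prim : (R -> R) -> R -> R) (f fk : R -> R).
Hypothesis primP : antiderivative_choice prim.
Hypothesis f_smooth : smooth1 f.
Hypothesis fk_smooth : smooth1 fk.
Hypothesis f_fk_neq0 : forall t, 3 * f t + fk t != 0.

Let w := fratio f fk.

Let w_smooth : smooth1 w. Proof. exact: smooth1_fratio. Qed.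

Let is_derive_prim t : is_derive t 1 (prim w) (w t).
Proof. by apply: primP; exact: smooth1_continuous. Qed.

Let is_derive_exp (c : R) t :
  is_derive t 1 (fun s => expR (c * prim w s)) (c * w t * expR (c * prim w t)).
Proof.
have dc := is_derive_mulcf c (is_derive_prim t).
have D := @is_derive1_comp _ _ (fun s => c * prim w s) _ _ _
  (is_derive_expR _) dc.
by apply: (is_derive_fun_eq D) => //; rewrite mulrC.
Qed.

Let expR_prim2 t : expR (- 2 * prim w t) = expR (- prim w t) ^+ 2.
Proof. by rewrite -expRM_natl; congr expR; ring. Qed.

Definition conformal_factor (C : R) t := C * expR (- prim w t).

Lemma is_derive_conformal_factor C t :
  is_derive t 1 (conformal_factor C) (- w t * conformal_factor C t).
Proof.
apply: (is_derive_fun_eq (is_derive_mulcf C (is_derive_exp (-1) t))).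
  by move=> s; rewrite mulN1r.
by rewrite /conformal_factor !mulN1r; ring.
Qed.

Lemma smooth1_conformal_factor C : smooth1 (conformal_factor C).
Proof.
apply: (smooth1_linear_ode (g := fun t => -1 * w t)).
  exact: (smooth1M (@smooth1_cst _ (-1)) w_smooth).
by move=> t; rewrite mulN1r; exact: is_derive_conformal_factor.
Qed.

Lemma is_derive2_conformal_factor C t :
  is_derive t 1 (fun s => - w s * conformal_factor C s)
    ((w t ^+ 2 - derive1 w t) * conformal_factor C t).
Proof.
have dw := is_derive_mulcf (-1) (smooth1_is_derive t w_smooth).
apply: (is_derive_fun_eq (is_derive_mulf dw (is_derive_conformal_factor C t))).
  by move=> s; rewrite mulN1r.
by ring.
Qed.

(** The right-hand side is the diagonal of [B = phi^2 T] for [phi = h(x_k)], in the k-th and in the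
    other places. It matches because [h'/h = -w], [h''/h = w^2 - w'] and [h^2 = C^2 v]. *)
Lemma ode_system_schouten C : 0 < C ->
  ode_system prim f fk C <->
  forall t, let h := conformal_factor C t in
    (w t ^+ 2 - derive1 w t) * h / h - 2^-1 * (- w t * h / h) ^+ 2
      = h ^+ 2 * fk t
    /\ - (2^-1 * (- w t * h / h) ^+ 2) = h ^+ 2 * f t.
Proof.
move=> C0; have E0 t : conformal_factor C t != 0.
  by rewrite mulf_neq0 ?gt_eqF ?expR_gt0.
have E2 t : conformal_factor C t ^+ 2 = C ^+ 2 * expR (- 2 * prim w t).
  by rewrite /conformal_factor exprMn expR_prim2.
rewrite /ode_system /= -/w.
by split=> H t; have := H t; rewrite /= !mulfK // E2 => -[H1 H2]; split; lra.
Qed.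

Lemma ode_system_unique C C' : 0 < C -> 0 < C' ->
  ode_system prim f fk C -> ode_system prim f fk C' -> C = C'.
Proof.
move=> C0 C'0 /(_ 0)[H1 H2] /(_ 0)[H1' H2'].
have v0 : expR (- 2 * prim (fratio f fk) 0) != 0 by rewrite gt_eqF ?expR_gt0.
(* The left-hand sides of the system do not involve the constant, so [(C^2 - C'^2) v] annihilates
   both [f] and [fk], hence also [3 f + fk]. *)
have CC : C ^+ 2 - C' ^+ 2 = 0.
  apply: (mulIf v0); apply: (mulIf (f_fk_neq0 0)).
  rewrite !mul0r; lra.
apply/eqP; rewrite -(eqrXn2 (n := 2)) ?ltW //.
by rewrite -subr_eq0 CC.
Qed.

(** Differentiating the second equation and eliminating [h''] gives the first-order equation
    [h' = - w h], whose solutions are the multiples of [exp(- prim w)]. *)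
Lemma conformal_factor_of_schouten (h dh ddh : R -> R) :
  (forall t, 0 < h t) ->
  (forall t, is_derive t 1 h (dh t)) ->
  (forall t, is_derive t 1 dh (ddh t)) ->
  (forall t, ddh t / h t - 2^-1 * (dh t / h t) ^+ 2 = h t ^+ 2 * fk t) ->
  (forall t, - (2^-1 * (dh t / h t) ^+ 2) = h t ^+ 2 * f t) ->
  exists C, [/\ 0 < C, ode_system prim f fk C &
    forall t, h t = conformal_factor C t].
Proof.
move=> h_gt0 Dh Ddh Hk Hf.
have h0 t : h t != 0 by rewrite gt_eqF.
(* Denominators are cleared and powers written as products, ready for the product rule. *)
have Hf' t : - (2^-1 * (dh t * dh t)) = (h t * h t) * (h t * h t) * f t.
  have := Hf t => /(congr1 (fun z => z * h t ^+ 2)).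
  by rewrite (_ : - _ * _ = - (2^-1 * (dh t * dh t))) => [->|]; field.
(* The difference of the two equations, multiplied by [h]. *)
have Hdd t : ddh t = h t ^+ 3 * (fk t - f t).
  have := congr1 (fun z => z * h t) (Hk t).
  have := congr1 (fun z => z * h t) (Hf t).
  rewrite mulrBl divfK // => E1 E2.
  have -> : ddh t = h t ^+ 2 * fk t * h t + 2^-1 * (dh t / h t) ^+ 2 * h t.
    by lra.
  move: E1; rewrite mulNr => E1.
  by rewrite -[_ * h t in X in _ + X]opprK E1; ring.
(* Both sides of [Hf'] are one function of [t], so their derivatives agree. *)
have Hdf t : - (dh t * ddh t)
    = 4 * h t ^+ 3 * dh t * f t + h t ^+ 4 * derive1 f t.
  have D1 := is_derive_mulcf (- 2^-1) (is_derive_mulf (Ddh t) (Ddh t)).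
  have D2 := is_derive_mulf (Dh t) (Dh t).
  have D3 := is_derive_mulf (is_derive_mulf D2 D2)
    (smooth1_is_derive t f_smooth).
  have E : (fun s => - 2^-1 * (dh s * dh s)) =
           (fun s => h s * h s * (h s * h s) * f s).
    by apply/funext => s; rewrite mulNr Hf'.
  rewrite E in D1.
  have := @derive_val _ _ _ _ _ _ _ D1; rewrite (@derive_val _ _ _ _ _ _ _ D3).
  move=> X; transitivity (- 2^-1 * (ddh t * dh t + dh t * ddh t)).
    by field.
  by rewrite -X; ring.
(* Inserting [Hdd] into [Hdf] and cancelling [h^3] leaves [h' (3 f + fk) = - h f']. *)
have Hw t : dh t = - w t * h t.
  rewrite /w /fratio; apply: (mulIf (f_fk_neq0 t)).
  rewrite [RHS](_ : _ = - derive1 f t * h t); last by field; exact: f_fk_neq0.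
  have h3 : h t ^+ 3 != 0 by rewrite expf_neq0.
  apply: (mulIf h3); have := Hdf t; rewrite Hdd; lra.
(* The integrating factor makes this product constant; its value is the constant [C]. *)
have Dc t : is_derive t 1 (fun s => h s * expR (1 * prim w s)) 0.
  apply: (is_derive_fun_eq (is_derive_mulf (Dh t) (is_derive_exp 1 t))) => //.
  by rewrite Hw; ring.
pose C := h 0 * expR (1 * prim w 0).
have C0 : 0 < C by rewrite mulr_gt0 ?expR_gt0.
have hE t : h t = conformal_factor C t.
  rewrite /conformal_factor /C -(@is_derive_0_is_cst _ _ t 0 Dc) mul1r -mulrA.
  by rewrite -expRD subrr expR0 mulr1.
exists C; split=> //; apply/ode_system_schouten => // t /=.
have Ew : ddh t = (w t ^+ 2 - derive1 w t) * h t.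
  have hE' : h = conformal_factor C by apply/funext.
  have dhE : dh = fun s => - w s * conformal_factor C s.
    by apply/funext => s; rewrite Hw hE'.
  have := Ddh t; rewrite dhE => D; have D' := is_derive2_conformal_factor C t.
  rewrite hE'; have := @derive_val _ _ _ _ _ _ _ D.
  by rewrite (@derive_val _ _ _ _ _ _ _ D').
by rewrite -hE -Ew -Hw Hk Hf.
Qed.

End OneVariable.

(** The difference quotient is identically zero, so derivability is a conclusion here. This yields
    the derivative of [dd k k] along another axis from invariance alone. *)
Lemma is_derive_invariant (R : realType) (V : normedModType R) (F : V -> R)
    (x v : V) : (forall s : R, F (x + s *: v) = F x) -> is_derive x v F 0.
Proof.
move=> Fx; have E : (fun h : R => h^-1 *: ((F \o shift x) (h *: v) - F x))
   = (fun _ : R => 0).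
  by apply/funext => h /=; rewrite (addrC (h *: v)) Fx subrr scaler0.
apply: DeriveDef; rewrite /derivable /derive E; first exact: is_cvg_cst.
exact: lim_cst.
Qed.

(** * Metrics with the prescribed curvature tensor *)

Section Prescribed.
Context {R : realType} {n : nat} (k : 'I_n).
Hypothesis n3 : (3 <= n)%N.
Variable fs : 'I_n -> R -> R.
Hypothesis fs_smooth : forall i, smooth1 (fs i).
Hypothesis fs_neq0 : forall i j : 'I_n, i != j ->
  forall t : R, 3 * fs i t + fs j t != 0.
Implicit Types (x : 'rV[R]_n) (i j : 'I_n).

Let T x : 'M[R]_n := diag_mx (\row_(i < n) fs i (x 0 k)).
Let Rt x := kulkarni_nomizu (T x) (euclidean R n).

Section Necessity.
Variables (phi : 'rV[R]_n -> R) (d : 'I_n -> 'rV[R]_n -> R).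
Variable dd : 'I_n -> 'I_n -> 'rV[R]_n -> R.
Hypothesis phi_gt0 : forall x, 0 < phi x.
Hypothesis dphi : forall i x, is_derive x (delta_mx 0 i) phi (d i x).
Hypothesis ddphi :
  forall i j x, is_derive x (delta_mx 0 i) (d j) (dd i j x).
(** Stands for the vanishing of the third derivative of [phi] taken twice along the k-th axis and
    once along the j-th. *)
Hypothesis ddkk_invariant : forall j, (forall x, dd j k x = 0) ->
  forall x (s : R), dd k k (x + s *: delta_mx 0 j) = dd k k x.
Hypothesis phi_curvature : forall x a b c e,
  riemann (conformal phi) x a b c e = Rt x a b c e.

Let phi_neq0 x : phi x != 0. Proof. by rewrite gt_eqF. Qed.

Let schouten x : conformal_schouten phi d dd x = phi x ^+ 2 *: T x.
Proof.
apply: kulkarni_nomizu_euclidean_inj => // a b c e ce.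
rewrite kulkarni_nomizuZl -/(Rt x) -phi_curvature.
rewrite (riemann_conformal phi_gt0 dphi ddphi) (eq_sym e) (negbTE ce).
by rewrite !mul0r subr0 mulVKf // expf_neq0.
Qed.

Let dd_offdiag i j x : i != j -> dd i j x = 0.
Proof.
move=> ij; have := congr1 (fun M : 'M[R]_n => M i j) (schouten x).
rewrite !mxE (negbTE ij) mulr0n mulr0 mul0r subr0 => /(congr1 ( *%R^~ (phi x))).
by rewrite divfK // mul0r.
Qed.

Let dd_diag i x : dd i i x / phi x - 2^-1 * \sum_p (d p x / phi x) ^+ 2
  = phi x ^+ 2 * fs i (x 0 k).
Proof.
have := congr1 (fun M : 'M[R]_n => M i i) (schouten x).
by rewrite !mxE eqxx mulr1n mul1r.
Qed.

(* Differentiating the k-th diagonal equation along e_j and eliminating the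
   second derivatives leaves (3 f_k + f_j) d_j phi = 0. *)
Let d_eq0 j x : j != k -> d j x = 0.
Proof.
move=> jk.
have diag i y : phi y * dd i i y + (- 2^-1) * (\sum_p d p y * d p y)
    = (phi y * phi y) * (phi y * phi y) * fs i (y 0 k).
  have -> : \sum_p d p y * d p y = phi y ^+ 2 * \sum_p (d p y / phi y) ^+ 2.
    by rewrite mulr_sumr; apply: eq_bigr => p _; field; exact: phi_neq0.
  have := congr1 ( *%R (phi y ^+ 2)) (dd_diag i y); set S := \sum_p _ => E.
  transitivity (phi y ^+ 2 * (phi y ^+ 2 * fs i (y 0 k))); last by ring.
  by rewrite -E; field; exact: phi_neq0.
have DL := is_derive_addf
  (is_derive_mulf (dphi j x)
    (is_derive_invariant (ddkk_invariant (fun y => dd_offdiag y jk) x)))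
  (is_derive_mulcf (- 2^-1) (is_derive_sumf
    (fun p => is_derive_mulf (ddphi j p x) (ddphi j p x)))).
have D2 := is_derive_mulf (dphi j x) (dphi j x).
have DR := is_derive_mulf (is_derive_mulf D2 D2)
  (is_derive_coord j (smooth1_is_derive (x 0 k) (@fs_smooth k))).
have {}DL := is_derive_fun_eq DL (diag k) erefl.
have := @derive_val _ _ _ _ _ _ _ DL; rewrite (@derive_val _ _ _ _ _ _ _ DR).
rewrite (negbTE jk) mul0r mulr0 addr0 mulr0 addr0.
rewrite (bigD1 j) //= big1 => [|p pj]; last first.
  by rewrite dd_offdiag 1?eq_sym // mul0r mulr0 addr0.
have Ek := congr1 ( *%R (d j x)) (diag k x).
have Ej := congr1 ( *%R (d j x)) (diag j x).
move=> /(congr1 ( *%R (phi x))) E.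
have f0 : 3 * fs k (x 0 k) + fs j (x 0 k) != 0.
  by apply: fs_neq0; rewrite eq_sym.
(* [E] contains [phi * (dd k k - dd j j)] times [d j], which [Ek - Ej] turns into
   [phi^4 * (f_k - f_j)] times [d j]. *)
apply: (mulIf f0); apply: (mulIf (expf_neq0 4 (phi_neq0 x))).
move: Ek Ej E; set S := \sum_p _; lra.
Qed.

Lemma necessity_one_variable : exists h dh ddh : R -> R,
  [/\ forall x, phi x = h (x 0 k),
      (forall t : R, is_derive t 1 h (dh t)),
      (forall t : R, is_derive t 1 dh (ddh t)),
      (forall t, ddh t / h t - 2^-1 * (dh t / h t) ^+ 2 = h t ^+ 2 * fs k t) &
      (forall i t, i != k ->
        - (2^-1 * (dh t / h t) ^+ 2) = h t ^+ 2 * fs i t)].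
Proof.
pose e : 'rV[R]_n := delta_mx 0 k.
(* The witnesses are restrictions to the k-th axis, in the shape expected by [is_derive_line]. *)
exists (fun t => phi (0 + t *: e)), (fun t => d k (0 + t *: e)),
  (fun t => dd k k (0 + t *: e)).
have ek (t : R) : (0 + t *: e) 0 k = t by rewrite !mxE !eqxx mulr1 add0r.
have sumk x : \sum_p (d p x / phi x) ^+ 2 = (d k x / phi x) ^+ 2.
  rewrite (bigD1 k) //= big1 ?addr0 // => p pk.
  by rewrite d_eq0 // mul0r expr0n.
split.
- move=> x; apply: (eq_fun_of_partial0 (k := k)).
  + by move=> j _ y; case: (dphi j y).
  + by move=> j jk y; rewrite (partial_val (dphi j y)) d_eq0.
  + by rewrite ek.
- by move=> t; exact: (is_derive_line (dphi k _)).
- by move=> t; exact: (is_derive_line (ddphi k k _)).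
- by move=> t; have := dd_diag k (0 + t *: e); rewrite sumk ek.
move=> i t ik; have := dd_diag i (0 + t *: e); rewrite sumk ek.
(* [d i] vanishes identically for [i != k], hence so does its derivative. *)
have dk0 y : dd i i y = 0.
  have di : d i = fun=> 0 by apply/funext => z; exact: d_eq0.
  have := ddphi i i y; rewrite di => D.
  have := @derive_val _ _ _ _ _ _ _ D.
  by rewrite (@derive_val _ _ _ _ _ _ _ (is_derive_cstf 0 _ _)) => <-.
by rewrite dk0 mul0r sub0r.
Qed.

End Necessity.

Variable prim : (R -> R) -> R -> R.
Hypothesis primP : antiderivative_choice prim.

Lemma conformal_solution_factor phi : conformal_solution Rt phi ->
  exists f C, [/\ (forall i, i != k -> fs i = f), 0 < C,
    ode_system prim f (fs k) C &
    forall x, phi x = conformal_factor prim f (fs k) C (x 0 k)].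
Proof.
case=> sphi phi_gt0 phi_curv.
have D1 i x : is_derive x (delta_mx 0 i) phi (partial i phi x).
  by apply: is_derive_partial; exact: (@Ck_derivable _ _ 0 phi i x (sphi 1%N)).
have d2 i j x : derivable (partial j phi) x (delta_mx 0 i).
  exact: (@Ck_derivable _ _ 0 _ i x (Ck_partial j (sphi 2%N))).
have D2 i j x := is_derive_partial (d2 i j x).
have D3 j : (forall x, partial j (partial k phi) x = 0) -> forall x (s : R),
    partial k (partial k phi) (x + s *: delta_mx 0 j)
    = partial k (partial k phi) x.
  exact: (partial_invariant k (d2 j k)).
have [h [dh [ddh [phiE Dh Ddh Hk Hi]]]] :=
  necessity_one_variable phi_gt0 D1 D2 D3 phi_curv.
have h_gt0 t : 0 < h t.
  by have := phi_gt0 (t *: delta_mx 0 k); rewrite phiE !mxE !eqxx mulr1.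
have [i ik _] := exists_third_index k k n3.
(* The left-hand side of [Hi] does not depend on the index. *)
have fE j : j != k -> fs j = fs i.
  move=> jk; apply/funext => t.
  have h2 : h t ^+ 2 != 0 by rewrite expf_neq0 ?gt_eqF.
  by apply: (mulfI h2); rewrite -!Hi.
have [C [C0 sysC hE]] := conformal_factor_of_schouten primP (@fs_smooth i)
  (@fs_smooth k) (fs_neq0 ik) h_gt0 Dh Ddh Hk (fun t => Hi i t ik).
by exists (fs i), C; split=> // x; rewrite phiE.
Qed.

Lemma conformal_factor_solution f C : (forall i, i != k -> fs i = f) -> 0 < C ->
  ode_system prim f (fs k) C ->
  conformal_solution Rt (fun x => conformal_factor prim f (fs k) C (x 0 k)).
Proof.
move=> fE C0 sysC; have [i ik _] := exists_third_index k k n3.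
have f_smooth : smooth1 f by rewrite -(fE i ik).
have f_neq0 t : 3 * f t + fs k t != 0 by rewrite -(fE i ik); exact: fs_neq0.
have /(ode_system_schouten _ _ _ C0) sysh := sysC.
set h := conformal_factor prim f (fs k) C; pose w := fratio f (fs k).
have h_gt0 t : 0 < h t by rewrite mulr_gt0 ?expR_gt0.
have Dh := is_derive_conformal_factor primP f_smooth (@fs_smooth k) f_neq0 C.
have Ddh := is_derive2_conformal_factor primP f_smooth (@fs_smooth k) f_neq0 C.
split; [|by move=> x; exact: h_gt0|].
  apply: smooth_coord.
  exact: (smooth1_conformal_factor primP f_smooth (@fs_smooth k) f_neq0).
move=> x a b c e.
(* Closed forms of the gradient and Hessian of [h(x_k)]: only the entries at [k] are nonzero. *)
pose d (p : 'I_n) (y : 'rV[R]_n) := (p == k)%:R * (- w (y 0 k) * h (y 0 k)).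
pose dd (p q : 'I_n) (y : 'rV[R]_n) := (q == k)%:R * ((p == k)%:R *
  ((w (y 0 k) ^+ 2 - derive1 w (y 0 k)) * h (y 0 k))).
have D1 p y : is_derive y (delta_mx 0 p) (fun x => h (x 0 k)) (d p y).
  exact: (is_derive_coord p (Dh _)).
have D2 p q y : is_derive y (delta_mx 0 p) (d q) (dd p q y).
  exact: (is_derive_mulcf _ (is_derive_coord p (Ddh _))).
rewrite (riemann_conformal (fun y => h_gt0 (y 0 k)) D1 D2).
set S := conformal_schouten _ _ _ x.
have -> : S = h (x 0 k) ^+ 2 *: T x.
  apply/matrixP => p q; rewrite !mxE /dd /d.
  rewrite (bigD1 k) //= eqxx big1 => [|j jk]; last first.
    by rewrite (negbTE jk) !mul0r expr0n.
  have [Hk Hf] := sysh (x 0 k).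
  rewrite addr0 !mul1r.
  have [<-|pq] := eqVneq p q; last first.
    rewrite mul0r subr0 mulr0n mulr0; have [pk|_] := eqVneq p k; last first.
      by rewrite mul0r mulr0 mul0r.
    by rewrite -pk eq_sym (negbTE pq) !mul0r.
  rewrite mulr1n mul1r; have [->|pk] := eqVneq p k; first by rewrite !mul1r -Hk.
  by rewrite !mul0r sub0r (fE p pk) -Hf.
rewrite kulkarni_nomizuZl.
(* Here all entries are required, including [e = c]; the extra term vanishes because the explicit
   [dd] is symmetric. *)
rewrite [X in _ - X](_ : _ = 0) ?subr0; last first.
  by rewrite /dd; field; rewrite gt_eqF.
by rewrite mulKf // expf_neq0 // gt_eqF.
Qed.

End Prescribed.

Unset Implicit Arguments.

Theorem theorem3p6 (R : realType) (n : nat) (hn : (3 <= n)%N) (k : 'I_n)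
    (fs : 'I_n -> R -> R)
    (fs_smooth : forall i, smooth1 (fs i))
    (fs_neq0 : forall i j : 'I_n, i != j ->
       forall t : R, 3 * fs i t + fs j t != 0)
    (prim : (R -> R) -> R -> R) (primP : antiderivative_choice prim) :
  let T := fun x : 'rV[R]_n => diag_mx (\row_(i < n) fs i (x 0 k)) in
  let Rt := fun x : 'rV[R]_n => kulkarni_nomizu (T x) (euclidean R n) in
  let conditions := fun (f : R -> R) (C : R) =>
    [/\ (forall i : 'I_n, i != k -> fs i = f), 0 < C &
        ode_system prim f (fs k) C] in
  ((exists phi : 'rV[R]_n -> R, conformal_solution Rt phi) <->
   (exists (f : R -> R) (C : R), conditions f C)) /\
  (forall (f : R -> R) (C : R), conditions f C ->
   forall phi : 'rV[R]_n -> R,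
     conformal_solution Rt phi <->
     (forall x, phi x = C * expR (- prim (fratio f (fs k)) (x 0 k)))).
Proof.
move=> T Rt conditions.
have necessary := conformal_solution_factor hn fs_smooth fs_neq0 primP.
have sufficient := conformal_factor_solution hn fs_smooth fs_neq0 primP.
split.
  split=> [[phi /necessary[f [C [fE C0 sysC _]]]]|[f [C [fE C0 sysC]]]].
    by exists f, C.
  exists (fun x => conformal_factor prim f (fs k) C (x 0 k)).
  exact: (sufficient _ _ _ fE C0 sysC).
move=> f C [fE C0 sysC] phi; split=> [|phiE]; last first.
  have -> : phi = fun x => conformal_factor prim f (fs k) C (x 0 k).
    exact/funext.
  exact: (sufficient _ _ _ fE C0 sysC).
(* The necessity part yields its own pair [f'], [C']. An index other than [k] identifies [f'] with
   [f], and uniqueness of the constant identifies [C'] with [C]. *)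
move=> /necessary[f' [C' [fE' C'0 sysC' phiE]]] x.
have [i ik _] := exists_third_index k k hn.
have ff : f' = f by rewrite -(fE i ik) (fE' i ik).
rewrite ff in sysC' phiE.
have f_neq0 t : 3 * f t + fs k t != 0 by rewrite -(fE i ik); exact: fs_neq0.
by rewrite (ode_system_unique f_neq0 C0 C'0 sysC sysC') phiE.
Qed.
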